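(* Consider $p_+=\tfrac12(b+\sqrt d)$ as a function of $(\rho_1,\rho_2,\rho\varepsilon)$ (all quantities as defined in the context). Writing $\mathrm{d}$ for the differential and $d$ for the discriminant $b^2+4c$, the differential of $p_+$ is expressed in terms of the differentials of $\rho_1$, $\rho_2$ and $\rho\varepsilon$ as $$\mathrm{d}p_+=\langle\mathcal{P}_k\,\mathrm{d}\rho_k\rangle+\mathcal{P}\,\mathrm{d}(\rho\varepsilon),$$ where, for $k=1,2$, $$\sqrt{d}\,\mathcal{P}_k=(-1)^{k+1}\mathcal{R}\rho_{3-k}-\sqrt{d}\,\mathcal{P}\,\varepsilon_{0k},\qquad \mathcal{R}=\frac{R_1c_{V2}\mathcal{H}_1-R_2c_{V1}\mathcal{H}_2}{(c_V\rho)^2},$$ $$\mathcal{H}_k=(\rho(\varepsilon-\varepsilon_0)-p_{*k})(p_+ +p_{*(3-k)}),\qquad \sqrt{d}\,\mathcal{P}=(\gamma-1)p_+ +\sigma^{(1)}p_{*2}+\sigma^{(2)}p_{*1}.$$ Consequently, the following Abgrall-type formula for the squared speed of sound $c_s^2$ holds: $$c_s^2=\Big\langle\frac{\rho_k}{\rho}\mathcal{P}_k\Big\rangle+\frac{\rho\varepsilon+p_+}{\rho}\mathcal{P}=\frac{\gamma(p_+ +p_{*1})(p_+ +p_{*2})}{\rho\sqrt{d}}.$$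
   Context: $\langle\cdot\rangle$ denotes summation over $k=1,2$. Physical constants for $k=1,2$: $c_{Vk}>0$, $\gamma_k>1$, $R_k=(\gamma_k-1)c_{Vk}>0$, $p_{*k}\geq 0$, $\varepsilon_{0k}\in\mathbb{R}$. A binary stiffened-gas mixture state consists of component densities $r_k>0$, volume fractions $0<\alpha_k<1$ ($k=1,2$) and a temperature $\theta>0$ such that $\alpha_1+\alpha_2=1$ and the component pressures $p_k=R_kr_k\theta-p_{*k}$ are equal to a common pressure: $p=p_1=p_2>0$. The component specific internal energies are $\varepsilon_k=c_{Vk}\theta+p_{*k}/r_k+\varepsilon_{0k}$. Put $\rho_k=\alpha_kr_k$, $\rho=\langle\rho_k\rangle$, and define $\varepsilon,\varepsilon_0,R,c_V,\gamma$ by $\rho\varepsilon=\langle\rho_k\varepsilon_k\rangle$, $\rho\varepsilon_0=\langle\rho_k\varepsilon_{0k}\rangle$, $\rho R=\langle R_k\rho_k\rangle$, $\rho c_V=\langle c_{Vk}\rho_k\rangle$, $\gamma=R/c_V+1$. Put $\sigma^{(k)}=\dfrac{R_k\rho_k}{c_V\rho}$, so $\langle\sigma^{(k)}\rangle=\gamma-1$, and $$b=\langle\sigma^{(k)}(\rho(\varepsilon-\varepsilon_0)-p_{*k})-p_{*k}\rangle,\qquad c=(\sigma^{(1)}p_{*2}+\sigma^{(2)}p_{*1})\rho(\varepsilon-\varepsilon_0)-\gamma p_{*1}p_{*2},\qquad d=b^2+4c.$$ It is known that at any mixture state $d>0$ and the common pressure is $p=p_+:=\tfrac12(b+\sqrt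 d)$. Through these formulas ($\rho,\ \rho\varepsilon_0,\ \rho c_V,\ \gamma,\ \sigma^{(k)}$ being functions of $\rho_1,\rho_2$), $b$, $c$, $d$ and $p_+$ are functions of the independent variables $(\rho_1,\rho_2,\rho\varepsilon)$ near any mixture state. The squared speed of sound is $c_s^2:=\partial_\rho p_++\frac{p_+}{\rho^2}\partial_\varepsilon p_+$, where $\partial_\rho$ and $\partial_\varepsilon$ are taken regarding $b$ and $c$ as functions of $(\rho,\varepsilon)$ with $\varepsilon_0$ and $\sigma^{(1)},\sigma^{(2)}$ (hence $\gamma$) held constant. *)

(* Defs.v *)
(* Stdlib reals with Coquelicot. *)
From Stdlib Require Import Reals.
From Coquelicot Require Import Coquelicot.

Open Scope R_scope.

Inductive phase : Set := ph1 | ph2.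

Definition index (k : phase) : nat := match k with ph1 => 1 | ph2 => 2 end.

(** The index [3 - k]. *)
Definition other (k : phase) : phase :=
  match k with ph1 => ph2 | ph2 => ph1 end.

(** The bracket [< . >]. *)
Definition sum2 (f : phase -> R) : R := f ph1 + f ph2.

Definition of_pair (x1 x2 : R) (k : phase) : R :=
  match k with ph1 => x1 | ph2 => x2 end.

Record stiffened_gas := StiffenedGas {
  cVk : R;
  gammak : R;
  pstar : R;
  eps0k : R;
  cVk_gt0 : 0 < cVk;
  gammak_gt1 : 1 < gammak;
  pstar_ge0 : 0 <= pstar
}.

Definition Rk (g : stiffened_gas) : R := (gammak g - 1) * cVk g.

Record mixture_state (g : phase -> stiffened_gas) := MixtureState {
  dens : phase -> R;
  vfrac : phase -> R;
  temp : R;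
  pressure : R;
  dens_gt0 : forall k, 0 < dens k;
  vfrac_bounds : forall k, 0 < vfrac k < 1;
  vfrac_sum : sum2 vfrac = 1;
  temp_gt0 : 0 < temp;
  pressure_gt0 : 0 < pressure;
  pressure_eq : forall k, Rk (g k) * dens k * temp - pstar (g k) = pressure
}.

Arguments dens {g} _ _.
Arguments vfrac {g} _ _.
Arguments temp {g} _.
Arguments pressure {g} _.

Definition rhok {g : phase -> stiffened_gas} (s : mixture_state g)
  (k : phase) : R := vfrac s k * dens s k.

Definition epsk {g : phase -> stiffened_gas} (s : mixture_state g)
  (k : phase) : R :=
  cVk (g k) * temp s + pstar (g k) / dens s k + eps0k (g k).

(** Internal energy per unit volume, [rho * eps]. *)
Definition energy {g : phase -> stiffened_gas} (s : mixture_state g) : R :=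
  sum2 (fun k => rhok s k * epsk s k).

(** [b], [c], [d] and [p_+] in terms of [(rho, eps)] and of
    [eps0, sigma, gamma], the latter three being independent arguments so that
    they can be frozen in the partial derivatives defining [sound_speed2]. *)
Section Frozen.

Variable ps : phase -> R.
Variables (rho eps eps0 : R) (sigma : phase -> R) (gamma : R).

Definition b_fr : R :=
  sum2 (fun k => sigma k * (rho * (eps - eps0) - ps k) - ps k).

Definition c_fr : R :=
  (sigma ph1 * ps ph2 + sigma ph2 * ps ph1) * (rho * (eps - eps0))
  - gamma * ps ph1 * ps ph2.

Definition d_fr : R := b_fr ^ 2 + 4 * c_fr.

Definition p_plus_fr : R := (b_fr + sqrt d_fr) / 2.

End Frozen.

(** All quantities as functions of the independent variables
    [(rho_1, rho_2, rho * eps)]; [v] stands for [(rho_1, rho_2)], [E] for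
    [rho * eps]. *)
Section Mixture.

Variable g : phase -> stiffened_gas.
Variables (v : phase -> R) (E : R).

Let ps (k : phase) : R := pstar (g k).

Definition rho : R := sum2 v.
Definition eps : R := E / rho.
Definition eps0 : R := sum2 (fun k => v k * eps0k (g k)) / rho.
Definition Rmix : R := sum2 (fun k => Rk (g k) * v k) / rho.
Definition cV : R := sum2 (fun k => cVk (g k) * v k) / rho.
Definition gamma : R := Rmix / cV + 1.
Definition sigma (k : phase) : R := Rk (g k) * v k / (cV * rho).

Definition d : R := d_fr ps rho eps eps0 sigma gamma.
Definition p_plus : R := p_plus_fr ps rho eps eps0 sigma gamma.

Definition calH (k : phase) : R :=
  (rho * (eps - eps0) - ps k) * (p_plus + ps (other k)).

Definition calR : R :=
  (Rk (g ph1) * cVk (g ph2) * calH ph1 - Rk (g ph2) * cVk (g ph1) * calH ph2)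
  / (cV * rho) ^ 2.

(** Division by [sqrt d] is harmless where these are used: [d > 0] at every
    mixture state. *)
Definition calP : R :=
  ((gamma - 1) * p_plus + sigma ph1 * ps ph2 + sigma ph2 * ps ph1) / sqrt d.

Definition calPk (k : phase) : R :=
  ((-1) ^ (index k + 1) * calR * v (other k) - sqrt d * calP * eps0k (g k))
  / sqrt d.

Definition p_plus_at_rho (x : R) : R := p_plus_fr ps x eps eps0 sigma gamma.
Definition p_plus_at_eps (x : R) : R := p_plus_fr ps rho x eps0 sigma gamma.

(** The squared speed of sound [c_s^2]: [eps0], [sigma] and [gamma] keep the
    values they have at [(v, E)]. *)
Definition sound_speed2 : R :=
  Derive p_plus_at_rho rho + p_plus / rho ^ 2 * Derive p_plus_at_eps eps.

End Mixture.

(* Main.v *)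
Require Import Defs.
From Stdlib Require Import Reals.
From Coquelicot Require Import Coquelicot.
From Stdlib Require Import Lra.
Open Scope R_scope.

(** Put [q = rho (eps - eps0)], the thermal energy per unit volume.  Since
    [gamma = 1 + sigma_1 + sigma_2], the pressure [p_+] is a function of the
    three quantities [sigma_1], [sigma_2], [q] alone: it is the larger root of

      [(p + p_1) (p + p_2) = sigma_1 (q - p_1) (p + p_2) + sigma_2 (q - p_2) (p + p_1)],

    where [p_k] is the constant [p_*k] (this is [p^2 = b p + c] factored).
    Implicit differentiation gives

      [sqrt d dp = H_1 dsigma_1 + H_2 dsigma_2
                   + ((gamma - 1) p + sigma_1 p_2 + sigma_2 p_1) dq],

    because the derivative of [p^2 - b p - c] in [p] is [2 p - b = sqrt d], and
    [H_k = (q - p_k) (p + p_(3-k))] is exactly the factor multiplying [sigma_k]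
    in the equation ([filterdiff_pressure]).  Everything else is a choice of
    [dsigma_k] and [dq].

    - As functions of [(rho_1, rho_2, rho eps)],
      [sigma_1 = R_1 rho_1 / (c_V1 rho_1 + c_V2 rho_2)] has differential
      [R_1 c_V2 (rho_2 drho_1 - rho_1 drho_2) / (c_V rho)^2], [sigma_2]
      similarly with the opposite sign, and
      [dq = d(rho eps) - <eps_0k drho_k>].  This yields the formula for [dp_+].
    - With [eps0] and [sigma] frozen, only [q] varies: [dq/drho = eps - eps0] and
      [dq/deps = rho], so [c_s^2 = P (q + p_+) / rho].
    - In the Abgrall-type combination the two [calR] terms
      [+- rho_1 rho_2 calR / rho] cancel, leaving again [P (q + p_+) / rho].
      Adding [(sigma_1 + sigma_2) (p + p_1) (p + p_2)] to both sides of the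
      factored equation turns it into
      [gamma (p + p_1) (p + p_2)
       = (q + p) ((gamma - 1) p + sigma_1 p_2 + sigma_2 p_1)],
      which is the closed form.

    Differentiability requires [d > 0].  At a mixture state
    [q = <alpha_k (c_Vk r_k theta + p_k)>] exceeds the convex combination
    [<alpha_k p_k>], hence the smaller of [p_1], [p_2]; if, say, [p_2] is the
    smaller one, the polynomial [p^2 - b p - c] is nonpositive at [-p_2], and
    negative there unless [p_1 = p_2], a case in which its roots [-p_1] and
    [(gamma - 1) (q - p_1) - p_1] are visibly distinct
    ([discriminant_gt0]). *)

(** * Calculus of differentials of real functions *)

Section RealDifferentials.

Context {U : NormedModule R_AbsRing}.
Implicit Types (f g lf lg : U -> R) (x : U).

Lemma filterdiff_eq_lin f lf lg x :
  filterdiff f (locally x) lf -> (forall h, lf h = lg h) ->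
  filterdiff f (locally x) lg.
Proof. exact (filterdiff_ext_lin (V := R_NormedModule) f lf lg). Qed.

Lemma filterdiff_eq_fun f g lf x :
  (forall u, f u = g u) -> filterdiff f (locally x) lf ->
  filterdiff g (locally x) lf.
Proof. exact (filterdiff_ext (V := R_NormedModule) f g lf). Qed.

Lemma filterdiff_Rplus f g lf lg x :
  filterdiff f (locally x) lf -> filterdiff g (locally x) lg ->
  filterdiff (fun u => f u + g u) (locally x) (fun h => lf h + lg h).
Proof.
  intros Hf Hg.
  exact (filterdiff_plus_fct (V := R_NormedModule) f g lf lg Hf Hg).
Qed.

Lemma filterdiff_Rminus f g lf lg x :
  filterdiff f (locally x) lf -> filterdiff g (locally x) lg ->
  filterdiff (fun u => f u - g u) (locally x) (fun h => lf h - lg h).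
Proof.
  intros Hf Hg.
  exact (filterdiff_minus_fct (V := R_NormedModule) f g lf lg Hf Hg).
Qed.

Lemma filterdiff_Rmult f g lf lg x :
  filterdiff f (locally x) lf -> filterdiff g (locally x) lg ->
  filterdiff (fun u => f u * g u) (locally x)
    (fun h => lf h * g x + f x * lg h).
Proof.
  exact (filterdiff_mult_fct (K := R_AbsRing) f g x lf lg Rmult_comm).
Qed.

Lemma filterdiff_cst (a : R) x :
  filterdiff (fun _ : U => a) (locally x) (fun _ => 0).
Proof. exact (filterdiff_const (V := R_NormedModule) a). Qed.

Lemma filterdiff_chain (phi : R -> R) f lf x (l : R) :
  filterdiff f (locally x) lf -> is_derive phi (f x) l ->
  filterdiff (fun u => phi (f u)) (locally x) (fun h => lf h * l).
Proof.
  intros Hf Hphi.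
  exact (filterdiff_comp' (V := R_NormedModule) (W := R_NormedModule)
           f phi x lf (fun y => scal y l) Hf Hphi).
Qed.

Lemma filterdiff_Rdiv f g lf lg x :
  g x <> 0 ->
  filterdiff f (locally x) lf -> filterdiff g (locally x) lg ->
  filterdiff (fun u => f u / g u) (locally x)
    (fun h => (lf h * g x - f x * lg h) / g x ^ 2).
Proof.
  intros Hgx Hf Hg.
  assert (Hinv : is_derive Rinv (g x) (- / g x ^ 2)).
  { evar_last; [apply (is_derive_inv (fun y => y)); [apply is_derive_id | exact Hgx] |].
    unfold one; simpl. field. exact Hgx. }
  eapply filterdiff_eq_lin.
  - exact (filterdiff_Rmult _ _ _ _ _ Hf (filterdiff_chain _ _ _ _ _ Hg Hinv)).
  - intros h; cbv beta. field. exact Hgx.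
Qed.

(** The formula one gets from [p^2 = b p + c] by [(2 p - b) dp = p db + dc],
    where [2 p - b] is the square root of the discriminant. *)
Lemma filterdiff_quadratic_root (b c lb lc : U -> R) x :
  0 < b x ^ 2 + 4 * c x ->
  filterdiff b (locally x) lb -> filterdiff c (locally x) lc ->
  filterdiff (fun u => (b u + sqrt (b u ^ 2 + 4 * c u)) / 2) (locally x)
    (fun h => ((b x + sqrt (b x ^ 2 + 4 * c x)) / 2 * lb h + lc h)
              / sqrt (b x ^ 2 + 4 * c x)).
Proof.
  intros Hd Hb Hc.
  set (D := fun u => b u ^ 2 + 4 * c u).
  assert (HD : filterdiff D (locally x) (fun h => 2 * b x * lb h + 4 * lc h)).
  { eapply filterdiff_eq_lin.
    - apply filterdiff_Rplus.
      + apply (filterdiff_chain (fun y => y ^ 2) _ _ _ (2 * b x) Hb).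
        auto_derive; [exact I | ring].
      + exact (filterdiff_Rmult _ _ _ _ _ (filterdiff_cst 4 x) Hc).
    - intros h; cbv beta. ring. }
  assert (Hsqrt : 0 < sqrt (D x)) by (apply sqrt_lt_R0; exact Hd).
  eapply filterdiff_eq_lin.
  - apply filterdiff_Rmult; [apply filterdiff_Rplus; [exact Hb |] | apply filterdiff_cst].
    exact (filterdiff_chain sqrt D _ _ _ HD (filterdiff_sqrt _ Hd)).
  - intros h; cbv beta. change (b x ^ 2 + 4 * c x) with (D x). field. lra.
Qed.

End RealDifferentials.

(** Syntax-directed differentiation of polynomial expressions.  The
    operands are read off by matching because higher-order unification may
    unfold them or instantiate the rules with constant functions. *)
Ltac poly_diff leaf :=
  lazymatch goal with
  | |- filterdiff (fun _ => ?a) _ _ => apply (filterdiff_cst a)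
  | |- filterdiff (fun u => @?f u + @?g u) _ _ =>
      apply (filterdiff_Rplus f g); poly_diff leaf
  | |- filterdiff (fun u => @?f u - @?g u) _ _ =>
      apply (filterdiff_Rminus f g); poly_diff leaf
  | |- filterdiff (fun u => @?f u * @?g u) _ _ =>
      apply (filterdiff_Rmult f g); poly_diff leaf
  | |- _ => leaf
  end.

(** * The pressure as a function of [sigma_1], [sigma_2] and [q] *)

Section PressureRoot.

Variables p1 p2 : R.

Definition lin_coef (s1 s2 q : R) : R :=
  (s1 * (q - p1) - p1) + (s2 * (q - p2) - p2).

Definition cst_coef (s1 s2 q : R) : R :=
  (s1 * p2 + s2 * p1) * q - (s1 + s2 + 1) * p1 * p2.

Definition discriminant (s1 s2 q : R) : R :=
  lin_coef s1 s2 q ^ 2 + 4 * cst_coef s1 s2 q.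

Definition pressure_root (s1 s2 q : R) : R :=
  (lin_coef s1 s2 q + sqrt (discriminant s1 s2 q)) / 2.

(** This is [p^2 = b p + c] rearranged: the left side is, up to division by
    [rho sqrt d], the speed of sound [calP (q + p) / rho], and the right side
    its closed form. *)
Lemma pressure_root_balance s1 s2 q :
  0 <= discriminant s1 s2 q ->
  let p := pressure_root s1 s2 q in
  (q + p) * ((s1 + s2) * p + s1 * p2 + s2 * p1)
  = (s1 + s2 + 1) * (p + p1) * (p + p2).
Proof.
  intros Hd p.
  assert (Hp : p ^ 2 = lin_coef s1 s2 q * p + cst_coef s1 s2 q).
  { unfold p, pressure_root.
    generalize (sqrt_sqrt _ Hd). unfold discriminant at 3. intros. nra. }
  clearbody p. unfold lin_coef, cst_coef in Hp. nra.
Qed.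

(** The discriminant is a square minus four times the value of the polynomial
    at [- p2], and that value is [s2 (q - p2) (p2 - p1) <= 0]. *)
Lemma discriminant_gt0_ordered s1 s2 q :
  0 < s1 -> 0 < s2 -> p2 <= p1 -> p2 < q -> 0 < discriminant s1 s2 q.
Proof.
  intros H1 H2 Hp Hq.
  replace (discriminant s1 s2 q) with
    (((1 + s1) * (p1 - p2) - (s1 + s2) * (q - p2)) ^ 2
     + 4 * (s2 * (q - p2) * (p1 - p2)))
    by (unfold discriminant, lin_coef, cst_coef; ring).
  destruct (Rle_lt_or_eq_dec _ _ Hp) as [Hlt | Heq].
  - assert (0 < s2 * (q - p2) * (p1 - p2))
      by (repeat apply Rmult_lt_0_compat; lra).
    generalize (pow2_ge_0 ((1 + s1) * (p1 - p2) - (s1 + s2) * (q - p2))). lra.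
  - (* the two roots are then [- p1] and [(s1 + s2) (q - p1) - p1] *)
    rewrite <- Heq. assert (0 < (s1 + s2) * (q - p2)) by (apply Rmult_lt_0_compat; lra).
    nra.
Qed.

End PressureRoot.

Lemma discriminant_gt0 p1 p2 s1 s2 q :
  0 < s1 -> 0 < s2 -> Rmin p1 p2 < q -> 0 < discriminant p1 p2 s1 s2 q.
Proof.
  intros H1 H2 Hq. destruct (Rle_lt_dec p2 p1) as [Hp | Hp].
  - rewrite Rmin_right in Hq by exact Hp.
    exact (discriminant_gt0_ordered p1 p2 s1 s2 q H1 H2 Hp Hq).
  - rewrite Rmin_left in Hq by lra.
    replace (discriminant p1 p2 s1 s2 q) with (discriminant p2 p1 s2 s1 q)
      by (unfold discriminant, lin_coef, cst_coef; ring).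
    apply discriminant_gt0_ordered; lra.
Qed.

(** The total differential of the root along arbitrary variations of
    [sigma_1], [sigma_2], [q]; it serves both for the differential in
    [(rho_1, rho_2, rho eps)] and, with constant [sigma], for the partial
    derivatives defining the speed of sound. *)
Lemma filterdiff_pressure {U : NormedModule R_AbsRing} (p1 p2 : R)
    (s1 s2 q ls1 ls2 lq : U -> R) (x : U) :
  0 < discriminant p1 p2 (s1 x) (s2 x) (q x) ->
  filterdiff s1 (locally x) ls1 -> filterdiff s2 (locally x) ls2 ->
  filterdiff q (locally x) lq ->
  let p := pressure_root p1 p2 (s1 x) (s2 x) (q x) in
  filterdiff (fun u => pressure_root p1 p2 (s1 u) (s2 u) (q u)) (locally x)
    (fun h => ((q x - p1) * (p + p2) * ls1 h + (q x - p2) * (p + p1) * ls2 h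
               + ((s1 x + s2 x) * p + s1 x * p2 + s2 x * p1) * lq h)
              / sqrt (discriminant p1 p2 (s1 x) (s2 x) (q x))).
Proof.
  intros Hd Hs1 Hs2 Hq p.
  assert (Hb : filterdiff (fun u => lin_coef p1 p2 (s1 u) (s2 u) (q u)) (locally x)
    (fun h => ls1 h * (q x - p1) + ls2 h * (q x - p2) + (s1 x + s2 x) * lq h)).
  { unfold lin_coef.
    eapply filterdiff_eq_lin.
    - poly_diff ltac:(first [ exact Hs1 | exact Hs2 | exact Hq ]).
    - intros h; cbv beta. ring. }
  assert (Hc : filterdiff (fun u => cst_coef p1 p2 (s1 u) (s2 u) (q u)) (locally x)
    (fun h => (ls1 h * p2 + ls2 h * p1) * q x + (s1 x * p2 + s2 x * p1) * lq h
              - (ls1 h + ls2 h) * p1 * p2)).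
  { unfold cst_coef.
    eapply filterdiff_eq_lin.
    - poly_diff ltac:(first [ exact Hs1 | exact Hs2 | exact Hq ]).
    - intros h; cbv beta. ring. }
  eapply filterdiff_eq_lin.
  - exact (filterdiff_quadratic_root _ _ _ _ x Hd Hb Hc).
  - intros h; cbv beta.
    fold (discriminant p1 p2 (s1 x) (s2 x) (q x)).
    fold (pressure_root p1 p2 (s1 x) (s2 x) (q x)). fold p.
    unfold Rdiv. f_equal. ring.
Qed.

(** * The mixture quantities in terms of [sigma] and [q] *)

Section MixtureQuantities.

Variable g : phase -> stiffened_gas.

Definition thermal_energy (v : phase -> R) (E : R) : R :=
  rho v * (eps v E - eps0 g v).

Lemma gamma_eq (v : phase -> R) : gamma g v = Defs.sigma g v ph1 + Defs.sigma g v ph2 + 1.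
Proof.
  unfold gamma, Defs.sigma, Rmix, sum2, Rdiv.
  rewrite Rinv_mult. ring.
Qed.

Lemma p_plus_fr_root (ps sg : phase -> R) (r e e0 gm : R) :
  gm = sg ph1 + sg ph2 + 1 ->
  p_plus_fr ps r e e0 sg gm
  = pressure_root (ps ph1) (ps ph2) (sg ph1) (sg ph2) (r * (e - e0)).
Proof. intros ->. reflexivity. Qed.

Lemma p_plus_root (v : phase -> R) (E : R) :
  p_plus g v E = pressure_root (pstar (g ph1)) (pstar (g ph2))
                   (Defs.sigma g v ph1) (Defs.sigma g v ph2) (thermal_energy v E).
Proof. exact (p_plus_fr_root _ _ _ _ _ _ (gamma_eq v)). Qed.

Lemma d_discriminant (v : phase -> R) (E : R) :
  d g v E = discriminant (pstar (g ph1)) (pstar (g ph2))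
              (Defs.sigma g v ph1) (Defs.sigma g v ph2) (thermal_energy v E).
Proof.
  unfold d, d_fr, b_fr, c_fr. rewrite gamma_eq. reflexivity.
Qed.

Lemma thermal_energy_eq (v : phase -> R) (E : R) :
  rho v <> 0 ->
  thermal_energy v E = E - (v ph1 * eps0k (g ph1) + v ph2 * eps0k (g ph2)).
Proof.
  intros Hr. unfold thermal_energy, eps, eps0, sum2. field. exact Hr.
Qed.

Lemma cV_rho_eq (v : phase -> R) :
  rho v <> 0 -> cV g v * rho v = cVk (g ph1) * v ph1 + cVk (g ph2) * v ph2.
Proof. intros Hr. unfold cV, sum2. field. exact Hr. Qed.

Lemma Rk_gt0 (k : phase) : 0 < Rk (g k).
Proof.
  unfold Rk. generalize (gammak_gt1 (g k)). intros.
  apply Rmult_lt_0_compat; [lra | apply cVk_gt0].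
Qed.

Lemma cV_rho_gt0 (v : phase -> R) : (forall k, 0 < v k) -> 0 < cV g v * rho v.
Proof.
  intros Hv. generalize (Hv ph1) (Hv ph2); intros.
  rewrite cV_rho_eq by (unfold rho, sum2; lra).
  apply Rplus_lt_0_compat; apply Rmult_lt_0_compat; auto using cVk_gt0.
Qed.

Lemma sigma_gt0 (v : phase -> R) (k : phase) :
  (forall k, 0 < v k) -> 0 < Defs.sigma g v k.
Proof.
  intros Hv. unfold Defs.sigma, Rdiv. apply Rmult_lt_0_compat.
  - apply Rmult_lt_0_compat; auto using Rk_gt0.
  - apply Rinv_0_lt_compat, cV_rho_gt0, Hv.
Qed.

(** * Differential of the pressure in the conservative variables *)

Notation densities x := (of_pair (fst (fst x)) (snd (fst x))).

Lemma filterdiff_density (k : phase) (x : R * R * R) :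
  filterdiff (fun y : R * R * R => densities y k) (locally x)
    (fun h : R * R * R => densities h k).
Proof.
  apply (filterdiff_linear (V := R_NormedModule) (fun y : R * R * R => densities y k)).
  destruct k; simpl.
  - apply (is_linear_comp (fun y : R * R * R => fst y) (fun y : R * R => fst y));
      apply is_linear_fst.
  - apply (is_linear_comp (fun y : R * R * R => fst y) (fun y : R * R => snd y));
      [apply is_linear_fst | apply is_linear_snd].
Qed.

Lemma filterdiff_snd3 (x : R * R * R) :
  filterdiff (fun y : R * R * R => snd y) (locally x) (fun h : R * R * R => snd h).
Proof.
  apply (filterdiff_linear (V := R_NormedModule) (fun y : R * R * R => snd y)).
  apply is_linear_snd.
Qed.

(** Positive total density is an open condition, so the formulas obtained by
    cancelling [rho] may be differentiated. *)
Lemma locally_rho_neq0 (x : R * R * R) :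
  0 < rho (densities x) -> locally x (fun y => rho (densities y) <> 0).
Proof.
  intros Hr.
  assert (Hc : continuous (fun y : R * R * R => rho (densities y)) x).
  { apply (filterdiff_continuous (V := R_NormedModule)
             (fun y : R * R * R => rho (densities y))).
    eexists. exact (filterdiff_Rplus _ _ _ _ _ (filterdiff_density ph1 x)
             (filterdiff_density ph2 x)). }
  assert (Hpos : locally x (fun y => 0 < rho (densities y)))
    by exact (Hc _ (open_gt 0 _ Hr)).
  revert Hpos. apply filter_imp. intros y Hy. lra.
Qed.

Lemma filterdiff_sigma (k : phase) (x : R * R * R) :
  let v := densities x in
  (forall j, 0 < v j) ->
  filterdiff (fun y : R * R * R => Defs.sigma g (densities y) k) (locally x)
    (fun h : R * R * R =>
       Rk (g k) * cVk (g (other k))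
       * (v (other k) * densities h k - v k * densities h (other k))
       / (cV g v * rho v) ^ 2).
Proof.
  intros v Hv.
  assert (Hr : 0 < rho v)
    by (unfold rho, sum2; generalize (Hv ph1) (Hv ph2); lra).
  pose proof (cV_rho_gt0 v Hv) as HS.
  rewrite cV_rho_eq in HS |- * by lra.
  apply filterdiff_ext_locally with
    (fun y : R * R * R => Rk (g k) * densities y k
       / (cVk (g ph1) * densities y ph1 + cVk (g ph2) * densities y ph2)).
  { apply filter_imp with (2 := locally_rho_neq0 x Hr).
    intros y Hy. unfold Defs.sigma. rewrite cV_rho_eq by exact Hy. reflexivity. }
  eapply filterdiff_eq_lin.
  - apply filterdiff_Rdiv; [unfold v in HS; lra | |];
      poly_diff ltac:(apply filterdiff_density).
  - intros h; cbv beta. fold v. unfold Rdiv. f_equal. destruct k; simpl; ring.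
Qed.

Lemma filterdiff_thermal_energy (x : R * R * R) :
  0 < rho (densities x) ->
  filterdiff (fun y : R * R * R => thermal_energy (densities y) (snd y)) (locally x)
    (fun h : R * R * R => snd h - sum2 (fun k => eps0k (g k) * densities h k)).
Proof.
  intros Hr.
  apply filterdiff_ext_locally with
    (fun y : R * R * R => snd y - (densities y ph1 * eps0k (g ph1)
                                   + densities y ph2 * eps0k (g ph2))).
  { apply filter_imp with (2 := locally_rho_neq0 x Hr).
    intros y Hy. rewrite thermal_energy_eq by exact Hy. reflexivity. }
  eapply filterdiff_eq_lin.
  - poly_diff ltac:(idtac; lazymatch goal with
                    | |- filterdiff (fun y => of_pair _ _ _) _ _ =>
                        apply filterdiff_density
                    | |- _ => apply filterdiff_snd3
                    end).
  - intros h; cbv beta. unfold sum2. simpl. ring.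
Qed.

Lemma filterdiff_p_plus (x : R * R * R) :
  let v := densities x in
  let E := snd x in
  (forall k, 0 < v k) -> 0 < d g v E ->
  filterdiff (fun y : R * R * R => p_plus g (densities y) (snd y)) (locally x)
    (fun h : R * R * R =>
       sum2 (fun k => calPk g v E k * densities h k) + calP g v E * snd h).
Proof.
  intros v E Hv Hd.
  assert (Hr : 0 < rho v)
    by (unfold rho, sum2; generalize (Hv ph1) (Hv ph2); lra).
  pose proof (cV_rho_gt0 v Hv) as HS.
  assert (Hsd : 0 < sqrt (d g v E)) by (apply sqrt_lt_R0, Hd).
  pose proof Hd as Hdisc. rewrite d_discriminant in Hdisc.
  apply filterdiff_eq_fun with
    (fun y : R * R * R => pressure_root (pstar (g ph1)) (pstar (g ph2))
       (Defs.sigma g (densities y) ph1) (Defs.sigma g (densities y) ph2)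
       (thermal_energy (densities y) (snd y))).
  { intros y. symmetry. apply p_plus_root. }
  eapply filterdiff_eq_lin.
  - exact (filterdiff_pressure _ _
             (fun y => Defs.sigma g (densities y) ph1)
             (fun y => Defs.sigma g (densities y) ph2)
             (fun y => thermal_energy (densities y) (snd y))
             _ _ _ x Hdisc (filterdiff_sigma ph1 x Hv)
             (filterdiff_sigma ph2 x Hv) (filterdiff_thermal_energy x Hr)).
  - intros h; cbv beta. change (densities x) with v; change (snd x) with E.
    rewrite <- d_discriminant, <- p_plus_root.
    unfold sum2, calPk, calP, calR, calH. rewrite gamma_eq.
    fold (thermal_energy v E). cbn [other index of_pair].
    (* keeps [field] from looking inside the square root and the denominator *)
    generalize dependent (sqrt (d g v E)). intros sd Hsd.
    generalize dependent (cV g v * rho v). intros S HS.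
    clearbody v E.
    simpl. field. split; lra.
Qed.

(** * Speed of sound *)

(** With [sigma] frozen only the [dq] term of the total differential remains,
    and its coefficient is [calP]; both partial derivatives in the speed of
    sound are instances, [q] being affine in [rho] and in [eps]. *)
Lemma is_derive_frozen_pressure (v : phase -> R) (E : R) (q : R -> R) (x lq : R) :
  0 < d g v E -> q x = thermal_energy v E -> is_derive q x lq ->
  is_derive (fun y => pressure_root (pstar (g ph1)) (pstar (g ph2))
               (Defs.sigma g v ph1) (Defs.sigma g v ph2) (q y)) x (calP g v E * lq).
Proof.
  intros Hd Hqx Hq.
  pose proof Hd as Hdisc. rewrite d_discriminant, <- Hqx in Hdisc.
  pose (R1 := AbsRing_NormedModule R_AbsRing).
  apply (filterdiff_eq_lin (U := R1) _ _ _ x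
    (filterdiff_pressure (U := R1) _ _ (fun _ => Defs.sigma g v ph1)
       (fun _ => Defs.sigma g v ph2) q _ _ _ x Hdisc
       (filterdiff_cst _ x) (filterdiff_cst _ x) Hq)).
  intros h; cbv beta. rewrite Hqx, <- d_discriminant, <- p_plus_root.
  unfold calP. rewrite gamma_eq. unfold scal; simpl; unfold mult; simpl.
  unfold Rdiv. ring.
Qed.

Lemma is_derive_p_plus_at_rho (v : phase -> R) (E : R) :
  0 < d g v E ->
  is_derive (p_plus_at_rho g v E) (rho v) (calP g v E * (eps v E - eps0 g v)).
Proof.
  intros Hd.
  apply is_derive_ext with
    (fun y => pressure_root (pstar (g ph1)) (pstar (g ph2))
       (Defs.sigma g v ph1) (Defs.sigma g v ph2) (y * (eps v E - eps0 g v))).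
  { intros y. symmetry. exact (p_plus_fr_root _ _ _ _ _ _ (gamma_eq v)). }
  apply (is_derive_frozen_pressure v E (fun y => y * (eps v E - eps0 g v)));
    [exact Hd | reflexivity |].
  auto_derive; [exact I | ring].
Qed.

Lemma is_derive_p_plus_at_eps (v : phase -> R) (E : R) :
  0 < d g v E ->
  is_derive (p_plus_at_eps g v) (eps v E) (calP g v E * rho v).
Proof.
  intros Hd.
  apply is_derive_ext with
    (fun y => pressure_root (pstar (g ph1)) (pstar (g ph2))
       (Defs.sigma g v ph1) (Defs.sigma g v ph2) (rho v * (y - eps0 g v))).
  { intros y. symmetry. exact (p_plus_fr_root _ _ _ _ _ _ (gamma_eq v)). }
  apply (is_derive_frozen_pressure v E (fun y => rho v * (y - eps0 g v)));
    [exact Hd | reflexivity |].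
  auto_derive; [exact I | ring].
Qed.

Lemma sound_speed2_eq (v : phase -> R) (E : R) :
  0 < rho v -> 0 < d g v E ->
  sound_speed2 g v E
  = calP g v E * (thermal_energy v E + p_plus g v E) / rho v.
Proof.
  intros Hr Hd. unfold sound_speed2.
  rewrite (is_derive_unique _ _ _ (is_derive_p_plus_at_rho v E Hd)).
  rewrite (is_derive_unique _ _ _ (is_derive_p_plus_at_eps v E Hd)).
  unfold thermal_energy. field. lra.
Qed.

(** The two [calR] terms are opposite, and the [eps_0k] terms turn [rho eps]
    into [q]. *)
Lemma abgrall_sum_eq (v : phase -> R) (E : R) :
  0 < rho v -> 0 < d g v E ->
  sum2 (fun k => v k / rho v * calPk g v E k)
  + (E + p_plus g v E) / rho v * calP g v E
  = calP g v E * (thermal_energy v E + p_plus g v E) / rho v.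
Proof.
  intros Hr Hd.
  assert (Hsd : 0 < sqrt (d g v E)) by (apply sqrt_lt_R0, Hd).
  rewrite thermal_energy_eq by lra.
  unfold sum2, calPk. cbn [other index].
  simpl. field. split; lra.
Qed.

Lemma sound_speed2_closed_form (v : phase -> R) (E : R) :
  0 < rho v -> 0 < d g v E ->
  calP g v E * (thermal_energy v E + p_plus g v E) / rho v
  = gamma g v * (p_plus g v E + pstar (g ph1)) * (p_plus g v E + pstar (g ph2))
    / (rho v * sqrt (d g v E)).
Proof.
  intros Hr Hd.
  assert (Hsd : 0 < sqrt (d g v E)) by (apply sqrt_lt_R0, Hd).
  pose proof Hd as Hdisc. rewrite d_discriminant in Hdisc.
  pose proof (pressure_root_balance _ _ _ _ _ (Rlt_le _ _ Hdisc)) as Hbal.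
  simpl in Hbal. rewrite <- p_plus_root in Hbal.
  unfold calP. rewrite gamma_eq, <- Hbal. field. split; lra.
Qed.

(** * Mixture states *)

Lemma rhok_gt0 (s : mixture_state g) (k : phase) : 0 < rhok s k.
Proof.
  apply Rmult_lt_0_compat; [apply (vfrac_bounds _ s k) | apply dens_gt0].
Qed.

(** Each phase contributes [alpha_k (r_k c_Vk theta + p_k)] to [q], and the
    volume fractions average [p_1] and [p_2]. *)
Lemma thermal_energy_gt_min (s : mixture_state g) :
  Rmin (pstar (g ph1)) (pstar (g ph2)) < thermal_energy (rhok s) (energy s).
Proof.
  pose proof (rhok_gt0 s ph1) as H1. pose proof (rhok_gt0 s ph2) as H2.
  assert (Hq : thermal_energy (rhok s) (energy s)
     = rhok s ph1 * (cVk (g ph1) * temp s) + rhok s ph2 * (cVk (g ph2) * temp s)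
       + (vfrac s ph1 * pstar (g ph1) + vfrac s ph2 * pstar (g ph2))).
  { rewrite thermal_energy_eq by (unfold rho, sum2; lra).
    unfold energy, epsk, rhok, sum2.
    generalize (dens_gt0 _ s ph1) (dens_gt0 _ s ph2); intros.
    field. split; lra. }
  assert (Hth : forall k, 0 < rhok s k * (cVk (g k) * temp s)).
  { intros k. apply Rmult_lt_0_compat; [apply rhok_gt0 |].
    apply Rmult_lt_0_compat; [apply cVk_gt0 | apply temp_gt0]. }
  generalize (Hth ph1) (Hth ph2) (vfrac_bounds _ s ph1) (vfrac_bounds _ s ph2)
    (vfrac_sum _ s) (Rmin_l (pstar (g ph1)) (pstar (g ph2)))
    (Rmin_r (pstar (g ph1)) (pstar (g ph2))).
  unfold sum2. rewrite Hq. set (m := Rmin _ _). intros. nra.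
Qed.

Lemma mixture_d_gt0 (s : mixture_state g) : 0 < d g (rhok s) (energy s).
Proof.
  rewrite d_discriminant.
  apply discriminant_gt0; auto using sigma_gt0, rhok_gt0, thermal_energy_gt_min.
Qed.

End MixtureQuantities.

Theorem proposition4 (g : phase -> stiffened_gas) (s : mixture_state g) :
  let v := rhok s in
  let E := energy s in
  filterdiff
    (fun x : R * R * R => p_plus g (of_pair (fst (fst x)) (snd (fst x))) (snd x))
    (locally (v ph1, v ph2, E))
    (fun h : R * R * R =>
       sum2 (fun k => calPk g v E k * of_pair (fst (fst h)) (snd (fst h)) k)
       + calP g v E * snd h)
  /\ ex_derive (p_plus_at_rho g v E) (rho v)
  /\ ex_derive (p_plus_at_eps g v) (eps v E)
  /\ sound_speed2 g v E
     = sum2 (fun k => v k / rho v * calPk g v E k)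
       + (E + p_plus g v E) / rho v * calP g v E
  /\ sum2 (fun k => v k / rho v * calPk g v E k)
       + (E + p_plus g v E) / rho v * calP g v E
     = gamma g v * (p_plus g v E + pstar (g ph1)) * (p_plus g v E + pstar (g ph2))
       / (rho v * sqrt (d g v E)).
Proof.
  intros v E.
  pose proof (rhok_gt0 g s) as Hv. fold v in Hv.
  pose proof (mixture_d_gt0 g s) as Hd. fold v E in Hd.
  assert (Hr : 0 < rho v)
    by (unfold rho, sum2; generalize (Hv ph1) (Hv ph2); lra).
  split; [| split; [| split; [| split]]].
  - (* a pair depends on its components only through the values at
       [ph1] and [ph2], so [of_pair (v ph1) (v ph2)] computes like [v] *)
    apply (filterdiff_p_plus g (v ph1, v ph2, E)).
    + intros []; apply Hv.
    + exact Hd.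
  - eexists. exact (is_derive_p_plus_at_rho g v E Hd).
  - eexists. exact (is_derive_p_plus_at_eps g v E Hd).
  - rewrite sound_speed2_eq, abgrall_sum_eq by assumption. reflexivity.
  - rewrite abgrall_sum_eq by assumption.
    exact (sound_speed2_closed_form g v E Hr Hd).
Qed.
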